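(* Let $A=(a_{i,j})_{i,j\in I}$ be a symmetrizable generalized Cartan matrix with $I$ finite, and let $\leq_{\mathrm{str}}$ be the string relation on the crystal $B(-\infty)$ (defined in the context). Then: (i) The relation $\leq_{\mathrm{str}}$ is a (partial) order on $B(-\infty)$. (ii) The transition matrix between two bases of canonical type of $\mathbf f$ is lower unitriangular with respect to $\leq_{\mathrm{str}}$. That is, let $\mathbf B'$ and $\mathbf B''$ be bases of canonical type of $\mathbf f$, both indexed by $B(-\infty)$, and for $b',b''\in B(-\infty)$ let $c_{b'',b'}$ be the coefficient of the element of $\mathbf B''$ indexed by $b''$ in the expansion on $\mathbf B''$ of the element of $\mathbf B'$ indexed by $b'$. Then $c_{b,b}=1$ for all $b\in B(-\infty)$, and $c_{b'',b'}\neq0$ implies $b'\leq_{\mathrm{str}}b''$.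
   Context: Let $\mathbf f$ be the $\mathbb Q$-algebra generated by elements $\theta_i$ ($i\in I$) subject to the relations $\sum_{p+q=1-a_{i,j}}(-1)^p\frac{\theta_i^p}{p!}\theta_j\frac{\theta_i^q}{q!}=0$ for all $i\neq j$ in $I$. It is graded by $Q_+=\bigoplus_{i\in I}\mathbb N\alpha_i$ (gradation by the weight), $\theta_i$ having weight $\alpha_i$. Let $\sigma$ be the antiautomorphism of $\mathbf f$ fixing each $\theta_i$, and let $\theta_i^{(n)}=\theta_i^n/n!$. A basis $\mathbf B$ of $\mathbf f$ is said to be of canonical type if: (1) its elements are weight vectors; (2) $1\in\mathbf B$; (3) each right ideal $\theta_i^p\mathbf f$ is spanned by a subset of $\mathbf B$; (4) in the bases induced by $\mathbf B$, left multiplication by $\theta_i^{(p)}$ from $\mathbf f/\theta_i\mathbf f$ onto $\theta_i^p\mathbf f/\theta_i^{p+1}\mathbf f$ is given by a permutation matrix; (5) $\mathbf B$ is stable by $\sigma$. Crystal structure. Let $\mathbf B$ be a basis of canonical type. For $b\in\mathbf B$, $\mathrm{wt}(b)$ is its weight, and $\varphi_i(b)$ is the largest $p\in\mathbb N$ with $b\in\theta_i^p\mathbf f$. For $b_0\in\mathbf B$ with $\varphi_i(b_0)=0$ and $n\in\mathbb N$, $\tilde e_i^nb_0$ is the unique element $b\in\mathbf B$ with $\varphi_i(b)=n$ and $b\equiv\theta_i^{(n)}b_0$ modulo $\theta_i^{n+1}\mathbf f$; every element of $\mathbf B$ is of this form for a unique $(n,b_0)$, and this defines $\tilde e_i:\mathbf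 B\to\mathbf B$. The operator $\tilde f_i$ is its partial inverse, with $\tilde f_ib=0$ (undefined) if $\varphi_i(b)=0$. By a theorem of Berenstein and Kazhdan, for any two bases of canonical type there is a unique bijection between them compatible with $\mathrm{wt}$, $\varphi_i$, $\tilde e_i$, $\tilde f_i$; it commutes with $\sigma$. The common underlying crystal, with its involution $\sigma$, is denoted $B(-\infty)$, and every basis of canonical type is thereby indexed by $B(-\infty)$. String relation. For $(b',b'')$ and $(c',c'')$ in $B(-\infty)^2$, write $(b',b'')\approx(c',c'')$ if one of the following holds: there is $i\in I$ with $\varphi_i(b')=\varphi_i(b'')$ and $(c',c'')=(\tilde e_ib',\tilde e_ib'')$; there is $i\in I$ with $\varphi_i(b')=\varphi_i(b'')>0$ and $(c',c'')=(\tilde f_ib',\tilde f_ib'')$; or $(c',c'')=(\sigma(b'),\sigma(b''))$. Write $b'\leq_{\mathrm{str}}b''$ if $b'$ and $b''$ have the same weight and, for any finite sequence $(b',b'')=(b'_0,b''_0)\approx(b'_1,b''_1)\approx\cdots\approx(b'_\ell,b''_\ell)$, one has $\varphi_i(b'_\ell)\leq\varphi_i(b''_\ell)$ for all $i\in I$. *)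

(* Defs.v *)
From HB Require Import structures.
From mathcomp Require Import all_boot all_order all_algebra.
From mathcomp Require Import boolp classical_sets functions.
From mathcomp Require Import finmap monalg.
From Stdlib Require Import Relation_Definitions Relation_Operators.

Set Implicit Arguments.
Unset Strict Implicit.
Unset Printing Implicit Defensive.

Import Order.TTheory GRing.Theory Num.Theory.

Local Open Scope classical_set_scope.
Local Open Scope ring_scope.
Local Open Scope quotient_scope.

Record symmetrizable_gcm (I : finType) (A : I -> I -> int) : Prop := {
  gcm_diag : forall i, A i i = 2%:Z;
  gcm_offdiag : forall i j, i != j -> A i j <= 0;
  gcm_zero : forall i j, A i j = 0 -> A j i = 0;
  gcm_symmetrizable : exists2 d : I -> int,
    forall i, 0 < d i & forall i j, d i * A i j = d j * A j i
}.

Section SerreRelations.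
Variables (K : fieldType) (I : finType) (A : I -> I -> int).

Definition divpow (R : lalgType K) (x : R) (n : nat) : R :=
  (n`!)%:R^-1 *: x ^+ n.

(* For i != j one has A i j <= 0, so that `|1 - A i j| = 1 - A i j. *)
Definition serre_rel (R : lalgType K) (t : I -> R) (i j : I) : R :=
  \sum_(p < `|1 - A i j|%N.+1)
    ((-1) ^+ p : K) *: (divpow (t i) p * t j * divpow (t i) (`|1 - A i j| - p)).

Lemma serre_rel_morph (R S : lalgType K) (f : {lrmorphism R -> S})
  (t : I -> R) i j : f (serre_rel t i j) = serre_rel (f \o t) i j.
Proof.
rewrite /serre_rel raddf_sum; apply: eq_bigr => p _.
have fZ (c : K) x : f (c *: x) = c *: f x by exact: linearZ_LR.
have fM x y : f (x * y) = f x * f y by exact: rmorphM.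
have fX x n : f (x ^+ n) = f x ^+ n by exact: rmorphXn.
by rewrite /= fZ !fM /divpow !fZ !fX.
Qed.

Lemma serre_rel_anti (R : lalgType K) (f : {additive R -> R}) (t : I -> R)
    (fZ : forall (c : K) x, f (c *: x) = c *: f x)
    (fM : forall x y, f (x * y) = f y * f x) 
    (f1 : f 1 = 1) (ft : forall i, f (t i) = t i) i j :
  f (serre_rel t i j) = (-1) ^+ `|1 - A i j|%N *: serre_rel t i j.
Proof.
have ftd k n : f (divpow (t k) n) = divpow (t k) n.
  rewrite fZ; congr (_ *: _); elim: n => [//|n IHn].
  by rewrite [in LHS]exprS fM IHn ft exprSr.
rewrite /serre_rel raddf_sum (reindex_inj rev_ord_inj) scaler_sumr /=.
apply: eq_bigr => p _; rewrite subSS.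
have pN : (p <= `|1 - A i j|)%N by rewrite -ltnS.
rewrite subKn // fZ !fM !ftd ft scalerA mulrA.
by rewrite -signr_odd oddB // signr_addb !signr_odd.
Qed.
End SerreRelations.

(* The free rat-algebra on I is the monoid algebra of the free monoid. *)
Notation free_alg I := {malg rat[{fmonom I}]}.

Section FreeAlgebra.
Variables (I : finType) (A : I -> I -> int).
Local Notation FA := (free_alg I).

Definition free_gen (i : I) : FA := << fmu i >>.

Lemma free_mulU (c d : rat) (u v : {fmonom I}) :
  (<< c *g u >> : FA) * << d *g v >> = << c * d *g mmul u v >>.
Proof. exact: fgmulUU. Qed.

Lemma free_commC (c : rat) (x : FA) : GRing.comm (c%:MP : FA) x.
Proof.
rewrite /GRing.comm [x]monalgE mulr_sumr mulr_suml; apply: eq_bigr => w _.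
by rewrite !free_mulU mul1m mulm1 mulrC.
Qed.

Lemma free_scalerAr (c : rat) (x y : FA) : c *: (x * y) = x * (c *: y).
Proof. by rewrite -!mul_malgC !mulrA free_commC. Qed.

Local Notation serre := (serre_rel A (free_gen : I -> FA)).

Definition frev (x : FA) : FA :=
  mmap (@malgC {fmonom I} rat) (fun w : {fmonom I} => << FMonom (rev w) >>) x.

Lemma frevU c w : frev << c *g w >> = << c *g FMonom (rev w) >>.
Proof. by rewrite /frev mmapU /= free_mulU mulr1 mul1m. Qed.

Lemma frev_is_zmod_morphism : zmod_morphism frev.
Proof. by move=> x y; rewrite /frev raddfB. Qed.
HB.instance Definition _ := GRing.isZmodMorphism.Build FA FA frev
  frev_is_zmod_morphism.

Lemma frevM x y : frev (x * y) = frev y * frev x.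
Proof.
rewrite [x]monalgE [y]monalgE mulr_sumr !raddf_sum /= mulr_suml.
apply: eq_bigr => v _; rewrite mulr_suml raddf_sum /= mulr_sumr.
apply: eq_bigr => u _; rewrite free_mulU !frevU free_mulU mulrC.
by congr (<< _ *g _ >>); apply/val_inj; rewrite /= !fmM /= rev_cat.
Qed.

Lemma frevZ (c : rat) x : frev (c *: x) = c *: frev x.
Proof.
rewrite -!mul_malgC frevM free_commC; congr (_ * _).
by rewrite frevU; congr (<< _ *g _ >>); apply/val_inj; rewrite /= fm1.
Qed.

Lemma frev1 : frev 1 = 1.
Proof. by rewrite frevU; congr (<< _ *g _ >>); apply/val_inj; rewrite /= fm1. Qed.

Lemma frev_gen i : frev (free_gen i) = free_gen i.
Proof. by rewrite frevU; congr (<< _ *g _ >>); apply/val_inj; rewrite /= fmU. Qed.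

(* The two-sided ideal generated by the Serre elements of free_alg I, for i != j. *)
Definition serre_ideal : set FA :=
  [set x | exists2 s : seq (FA * (I * I) * FA),
     all (fun t => t.1.2.1 != t.1.2.2) s &
     x = \sum_(t <- s) t.1.1 * serre t.1.2.1 t.1.2.2 * t.2].

Definition serre_pred : {pred FA} := fun x => `[< serre_ideal x >].

Lemma serre_predP x : reflect (serre_ideal x) (x \in serre_pred).
Proof. exact: asboolP. Qed.

Lemma serre_predMl u x : x \in serre_pred -> u * x \in serre_pred.
Proof.
move=> /serre_predP[s hs ->]; apply/serre_predP.
exists [seq (u * t.1.1, t.1.2, t.2) | t <- s]; first by rewrite all_map.
by rewrite big_map mulr_sumr; apply: eq_bigr => t _; rewrite !mulrA.
Qed.

Lemma serre_predMr u x : x \in serre_pred -> x * u \in serre_pred.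
Proof.
move=> /serre_predP[s hs ->]; apply/serre_predP.
exists [seq (t.1, t.2 * u) | t <- s]; first by rewrite all_map.
by rewrite big_map mulr_suml; apply: eq_bigr => t _; rewrite !mulrA.
Qed.

Lemma serre_pred_serre i j : i != j -> serre i j \in serre_pred.
Proof.
move=> ij; apply/serre_predP; exists [:: (1, (i, j), 1)]; first by rewrite /= ij.
by rewrite big_seq1 mul1r mulr1.
Qed.

Lemma frev_serre i j : frev (serre i j) =
  (-1) ^+ `|1 - A i j|%N *: serre i j.
Proof. exact: (@serre_rel_anti rat I A FA frev free_gen frevZ frevM frev1 frev_gen). Qed.

Lemma serre_pred_zmod : zmod_closed serre_pred.
Proof.
split; first by apply/serre_predP; exists [::]; rewrite ?big_nil.
move=> x y /serre_predP[s hs ->] hy.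
have /serre_predP[r hr ->] : - y \in serre_pred.
  by rewrite -mulN1r; exact: serre_predMl.
by apply/serre_predP; exists (s ++ r); rewrite ?all_cat ?hs ?hr ?big_cat.
Qed.

HB.instance Definition _ := GRing.isZmodClosed.Build FA serre_pred
  serre_pred_zmod.

Lemma serre_predZ (c : rat) x : x \in serre_pred -> c *: x \in serre_pred.
Proof. by move=> hx; rewrite -mul_malgC serre_predMl. Qed.

Lemma serre_pred_frev x : x \in serre_pred -> frev x \in serre_pred.
Proof.
move=> /serre_predP[s /allP hs ->]; rewrite raddf_sum big_seq rpred_sum // => t ts.
rewrite /= !frevM frev_serre; apply/serre_predMl/serre_predMr/serre_predZ.
exact/serre_pred_serre/hs.
Qed.

Lemma serre_pred1 : 1 \notin serre_pred.
Proof.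
apply/serre_predP => -[s hs] /(congr1 (mcoeff mone)).
rewrite raddf_sum /= mcoeff1 eqxx big1_seq => [/eqP|t /= ts].
  by rewrite oner_eq0.
have g0 i : (free_gen i)@_(mone : {fmonom I}) = 0.
  by rewrite mcoeffU1 -(inj_eq val_inj) /= fm1 fmU.
rewrite !rmorphM /= raddf_sum /= big1 ?mulr0 ?mul0r // => p _.
by rewrite mcoeffZ !rmorphM /= g0 mulr0 mul0r mulr0.
Qed.

End FreeAlgebra.

Section Algebra.
Variables (I : finType) (A : I -> I -> int).
Local Notation FA := (free_alg I).

Definition falg := Quotient.quot (serre_pred A : zmodClosed FA).
HB.instance Definition _ := GRing.Zmodule.on falg.

Definition fpi (x : FA) : falg := \pi_(Quotient.quot (serre_pred A : zmodClosed FA)) x.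
Definition frepr (x : falg) : FA :=
  repr (x : Quotient.quot (serre_pred A : zmodClosed FA)).

Lemma freprK x : fpi (frepr x) = x.
Proof. exact: reprK. Qed.

Lemma fpi_eq x y : (fpi x = fpi y) <-> (x - y \in serre_pred A).
Proof.
by rewrite (Quotient.idealrBE (serre_pred A : zmodClosed FA)); split => [/eqP|/eqP].
Qed.

Lemma fpiB x y : fpi (x - y) = fpi x - fpi y.
Proof. exact: raddfB. Qed.
HB.instance Definition _ := GRing.isZmodMorphism.Build FA falg fpi fpiB.

Definition fone : falg := fpi 1.
Definition fmul (x y : falg) : falg := fpi (frepr x * frepr y).
Definition fscale (c : rat) (x : falg) : falg := fpi (c *: frepr x).

Lemma frepr_pi x : frepr (fpi x) - x \in serre_pred A.
Proof. by apply/fpi_eq; rewrite freprK. Qed.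

Lemma fpi_mul x y : fmul (fpi x) (fpi y) = fpi (x * y).
Proof.
apply/fpi_eq; set x' := frepr _; set y' := frepr _.
have -> : x' * y' - x * y = (x' - x) * y' + x * (y' - y).
  by rewrite mulrBl mulrBr addrA subrK.
apply: rpredD; first exact/serre_predMr/frepr_pi.
exact/serre_predMl/frepr_pi.
Qed.

Lemma fpi_scale c x : fscale c (fpi x) = fpi (c *: x).
Proof. by apply/fpi_eq; rewrite -scalerBr; apply/serre_predZ/frepr_pi. Qed.

Lemma fpi_surj (x : falg) : exists y, x = fpi y.
Proof. by exists (frepr x); rewrite freprK. Qed.

Lemma fmulA : associative fmul.
Proof.
by move=> x y z; have [{}x ->] := fpi_surj x; have [{}y ->] := fpi_surj y;
  have [{}z ->] := fpi_surj z; rewrite !fpi_mul mulrA.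
Qed.
Lemma fmul1 : left_id fone fmul.
Proof. by move=> x; have [{}x ->] := fpi_surj x; rewrite fpi_mul mul1r. Qed.
Lemma fmulr1 : right_id fone fmul.
Proof. by move=> x; have [{}x ->] := fpi_surj x; rewrite fpi_mul mulr1. Qed.
Lemma fmulDl : left_distributive fmul +%R.
Proof.
move=> x y z; have [{}x ->] := fpi_surj x; have [{}y ->] := fpi_surj y;
  have [{}z ->] := fpi_surj z.
by rewrite -raddfD !fpi_mul -raddfD mulrDl.
Qed.
Lemma fmulDr : right_distributive fmul +%R.
Proof.
move=> x y z; have [{}x ->] := fpi_surj x; have [{}y ->] := fpi_surj y;
  have [{}z ->] := fpi_surj z.
by rewrite -raddfD !fpi_mul -raddfD mulrDr.
Qed.
Lemma fone_neq0 : fone != 0.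
Proof.
apply/eqP; rewrite -(raddf0 fpi) => /fpi_eq; rewrite subr0.
exact/negP/serre_pred1.
Qed.
HB.instance Definition _ := GRing.Zmodule_isNzRing.Build falg
  fmulA fmul1 fmulr1 fmulDl fmulDr fone_neq0.

Lemma fscaleA a b x : fscale a (fscale b x) = fscale (a * b) x.
Proof. by have [{}x ->] := fpi_surj x; rewrite !fpi_scale scalerA. Qed.
Lemma fscale1 : left_id 1 fscale.
Proof. by move=> x; have [{}x ->] := fpi_surj x; rewrite fpi_scale scale1r. Qed.
Lemma fscaleDr : right_distributive fscale +%R.
Proof.
move=> c x y; have [{}x ->] := fpi_surj x; have [{}y ->] := fpi_surj y.
by rewrite -raddfD !fpi_scale -raddfD scalerDr.
Qed.
Lemma fscaleDl x : {morph fscale^~ x : a b / a + b}.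
Proof.
by have [{}x -> a b] := fpi_surj x; rewrite !fpi_scale -raddfD scalerDl.
Qed.
HB.instance Definition _ := GRing.Zmodule_isLmodule.Build rat falg
  fscaleA fscale1 fscaleDr fscaleDl.

Lemma fscaleAl (c : rat) (x y : falg) : c *: (x * y) = (c *: x) * y.
Proof.
have [{}x ->] := fpi_surj x; have [{}y ->] := fpi_surj y.
rewrite /GRing.scale /= /GRing.mul /= !(fpi_mul, fpi_scale).
by rewrite -scalerAl.
Qed.
HB.instance Definition _ := GRing.Lmodule_isLalgebra.Build rat falg fscaleAl.

Lemma fscaleAr (c : rat) (x y : falg) : c *: (x * y) = x * (c *: y).
Proof.
have [{}x ->] := fpi_surj x; have [{}y ->] := fpi_surj y.
rewrite /GRing.scale /= /GRing.mul /= !(fpi_mul, fpi_scale).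
by rewrite free_scalerAr.
Qed.
HB.instance Definition _ := GRing.Lalgebra_isAlgebra.Build rat falg fscaleAr.

Lemma fpi_monoid : monoid_morphism fpi.
Proof. by split=> [//|x y]; rewrite -fpi_mul. Qed.
HB.instance Definition _ := GRing.isMonoidMorphism.Build FA falg fpi fpi_monoid.

Lemma fpi_scalable : scalable fpi.
Proof. by move=> c x; rewrite -fpi_scale. Qed.
HB.instance Definition _ := GRing.isScalable.Build rat FA falg *:%R fpi
  fpi_scalable.

Definition theta (i : I) : falg := fpi (free_gen i).
Definition theta_div (i : I) (n : nat) : falg := divpow (theta i) n.

Lemma theta_serre i j : i != j -> serre_rel A theta i j = 0.
Proof.
move=> ij; rewrite -[LHS](serre_rel_morph A (fpi : {lrmorphism FA -> falg}) (@free_gen I)).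
by rewrite -(raddf0 fpi); apply/fpi_eq; rewrite subr0 serre_pred_serre.
Qed.

Definition sigma (x : falg) : falg := fpi (frev (frepr x)).

Lemma sigma_pi x : sigma (fpi x) = fpi (frev x).
Proof. by apply/fpi_eq; rewrite -raddfB; apply/serre_pred_frev/frepr_pi. Qed.

Lemma sigma_linear : linear sigma.
Proof.
move=> c x y; have [{}x ->] := fpi_surj x; have [{}y ->] := fpi_surj y.
by rewrite -linearP !sigma_pi raddfD /= frevZ linearP.
Qed.

Lemma sigma1 : sigma 1 = 1.
Proof. by rewrite -(rmorph1 fpi) sigma_pi frev1. Qed.

Lemma sigmaM x y : sigma (x * y) = sigma y * sigma x.
Proof.
have [{}x ->] := fpi_surj x; have [{}y ->] := fpi_surj y.
by rewrite -rmorphM !sigma_pi frevM rmorphM.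
Qed.

Lemma sigma_theta i : sigma (theta i) = theta i.
Proof. by rewrite sigma_pi frev_gen. Qed.

End Algebra.

Section LinearCombinations.
Variables (F : lmodType rat).

(* A finitely supported family of coefficients is a c : {malg rat[F]}. *)
Definition combination (c : {malg rat[F]}) : F :=
  \sum_(x <- msupp c) c@_x *: x.

Definition supported (S : set F) (c : {malg rat[F]}) : Prop :=
  forall x, x \in msupp c -> S x.

Definition span (S : set F) : set F := [set combination c | c in supported S].

Definition independent (S : set F) : Prop :=
  forall c, supported S c -> combination c = 0 -> c = 0.

Definition is_basis (S : set F) : Prop := independent S /\ span S = setT.

Definition coef (S : set F) (b x : F) : rat :=
  (xget 0 [set c | supported S c /\ combination c = x])@_b.

End LinearCombinations.

Section CanonicalType.
Variables (I : finType) (A : I -> I -> int).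
Local Notation f := (falg A).
Local Notation theta := (theta A).

Definition weight_space (nu : {ffun I -> nat}) : set f :=
  span [set \prod_(i <- w) theta i | w in
          [set w : seq I | forall i, count_mem i w = nu i]].

Definition right_ideal (i : I) (p : nat) : set f :=
  range (fun x : f => theta i ^+ p * x).

(* In ct_permutation, the bases induced by B in f / theta_i f and in
   theta_i^p f / theta_i^(p+1) f are the images of the elements of B lying in
   the larger space and outside the smaller one. *)
Record canonical_type (B : set f) : Prop := {
  ct_basis : is_basis B;
  ct_weight : forall b, B b -> exists nu, weight_space nu b;
  ct_one : B 1;
  ct_right_ideal : forall i p,
    exists2 S : set f, S `<=` B & right_ideal i p = span S;
  ct_permutation : forall i p, exists pi : f -> f,
    set_bij (B `\` right_ideal i 1)
            ((B `&` right_ideal i p) `\` right_ideal i p.+1) pi /\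
    forall b, (B `\` right_ideal i 1) b ->
      right_ideal i p.+1 (theta_div A i p * b - pi b);
  ct_sigma : forall b, B b -> B (sigma b)
}.

End CanonicalType.

(* cr_f i b = None stands for "f_i b = 0", i.e. f_i is not defined at b. *)
Record crystal (I : finType) := Crystal {
  cr_carrier :> Type;
  cr_wt : cr_carrier -> {ffun I -> nat};
  cr_phi : I -> cr_carrier -> nat;
  cr_e : I -> cr_carrier -> cr_carrier;
  cr_f : I -> cr_carrier -> option cr_carrier;
  cr_sigma : cr_carrier -> cr_carrier
}.

(* In this section every xget describes an object which exists and is unique
   when B is of canonical type; its default value is then irrelevant. *)
Section BasisCrystal.
Variables (I : finType) (A : I -> I -> int) (B : set (falg A)).
Implicit Types (b : B) (i : I) (n : nat).

Definition basis_wt b : {ffun I -> nat} :=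
  xget [ffun=> 0%N] [set nu | weight_space nu (val b)].

Definition basis_phi i b : nat :=
  xget 0%N [set p | right_ideal i p (val b) /\
                    forall q, right_ideal i q (val b) -> (q <= p)%N].

(* b is the element e_i^n b0, for b0 such that phi_i(b0) = 0 *)
Definition basis_e_string i n b0 b : Prop :=
  [/\ basis_phi i b0 = 0%N, basis_phi i b = n &
      right_ideal i n.+1 (val b - theta_div A i n * val b0)].

Definition basis_e i b : B :=
  xget b [set b' | exists n b0,
    basis_e_string i n b0 b /\ basis_e_string i n.+1 b0 b'].

Definition basis_f i b : option B :=
  if basis_phi i b == 0%N then None
  else Some (xget b [set b' | basis_e i b' = b]).

Definition basis_sigma b : B := xget b [set b' | val b' = sigma (val b)].

Definition basis_crystal : crystal I :=
  Crystal basis_wt basis_phi basis_e basis_f basis_sigma.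

End BasisCrystal.

Section CrystalTheory.
Variable I : finType.

Record crystal_iso (X Y : crystal I) (h : X -> Y) : Prop := {
  iso_bij : bijective h;
  iso_wt : forall x, cr_wt (h x) = cr_wt x;
  iso_phi : forall i x, cr_phi i (h x) = cr_phi i x;
  iso_e : forall i x, cr_e i (h x) = h (cr_e i x);
  iso_f : forall i x, cr_f i (h x) = omap h (cr_f i x)
}.

(* X is the common crystal (with involution) of the bases of canonical type.
   By Berenstein and Kazhdan these are all isomorphic, so one of them suffices. *)
Definition is_B_infty (A : I -> I -> int) (X : crystal I) : Prop :=
  exists2 B : set (falg A), canonical_type B &
  exists2 h : X -> basis_crystal B, crystal_iso h &
    forall x, h (cr_sigma x) = cr_sigma (h x).

Variable X : crystal I.
Implicit Types b c : X * X.

Definition approx b c : Prop :=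
  [\/ exists i, cr_phi i b.1 = cr_phi i b.2 /\ c = (cr_e i b.1, cr_e i b.2),
      exists i, [/\ cr_phi i b.1 = cr_phi i b.2, (0 < cr_phi i b.2)%N,
                    cr_f i b.1 = Some c.1 & cr_f i b.2 = Some c.2] |
      c = (cr_sigma b.1, cr_sigma b.2)].

Definition le_str (x y : X) : Prop :=
  cr_wt x = cr_wt y /\
  forall c, clos_refl_trans (X * X) approx (x, y) c ->
    forall i, (cr_phi i c.1 <= cr_phi i c.2)%N.

End CrystalTheory.

(* Main.v *)
(* Each theta_i^p f is spanned by basis elements, so the coefficient c_{b'',b'} of
   b'' in b' can be nonzero only if phi_i(b') <= phi_i(b''); comparing
   theta_i^(n) b_0' and theta_i^(n) b_0'' modulo theta_i^(n+1) f shows that e_i and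
   f_i preserve this coefficient when phi_i(b') = phi_i(b''), and so does sigma.
   Hence c_{b'',b'} <> 0 propagates along every chain of the string relation.
   Diagonal coefficients are 1 by induction on the height, from b = 1.

   That the crystal isomorphism between two bases commutes with sigma is obtained as
   follows: composing it with sigma on both sides gives a second bijection along
   which all coefficients are 1.  The two differ by a weight-preserving permutation
   h of the crystal with x <= h x for the order defined without sigma; as weight
   spaces are finite, h is the identity. *)
Require Import Defs.
From HB Require Import structures.
From mathcomp Require Import all_boot all_order all_algebra.
From mathcomp Require Import boolp classical_sets functions.
From mathcomp Require Import finmap monalg.
From Stdlib Require Import Relation_Definitions Relation_Operators.

Set Implicit Arguments.
Unset Strict Implicit.
Unset Printing Implicit Defensive.

Import Order.TTheory GRing.Theory Num.Theory.

Local Open Scope ring_scope.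

(** * The weight grading of f *)

Section Grading.
Variables (I : finType) (A : I -> I -> int).
Local Notation FA := (free_alg I).
Local Notation weight := {ffun I -> nat}.
Implicit Types (mu nu : weight) (w : {fmonom I}) (i : I).

Definition alpha i : weight := [ffun j => (i == j) : nat].

Definition word_wt (w : seq I) : weight := [ffun i => count_mem i w].

Lemma word_wt_cat (u v : seq I) :
  word_wt (u ++ v) = [ffun i => (word_wt u i + word_wt v i)%N].
Proof. by apply/ffunP => i; rewrite !ffunE count_cat. Qed.

Definition free_comp nu (x : FA) : FA :=
  [malg w in msupp x => if word_wt w == nu then x@_w else 0].

Lemma free_compE nu x w :
  (free_comp nu x)@_w = if word_wt w == nu then x@_w else 0.
Proof.
rewrite mcoeffE; case: ifP => // /negbT wx.
by rewrite (mcoeff_outdom wx); case: ifP.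
Qed.

Lemma free_comp_linear nu : linear (free_comp nu).
Proof.
move=> c x y; apply/malgP => w; rewrite mcoeffD mcoeffZ !free_compE mcoeffD mcoeffZ.
by case: ifP => // _; rewrite mulr0 addr0.
Qed.
HB.instance Definition _ nu :=
  GRing.isLinear.Build rat FA FA *:%R (free_comp nu) (free_comp_linear nu).

Lemma free_compU nu c w :
  free_comp nu << c *g w >> = if word_wt w == nu then << c *g w >> else 0.
Proof.
apply/malgP => v; rewrite free_compE mcoeffU.
have [->|wv] := eqVneq w v; first by case: ifP; rewrite ?mcoeffUU // mcoeff0.
by rewrite mulr0n; case: ifP; case: ifP => _ _; rewrite ?mcoeff0 // mcoeffU (negPf wv).
Qed.

(** Phrased through coefficients, so that 0 is homogeneous of every weight. *)
Definition homogeneous nu (x : FA) := forall w, x@_w != 0 -> word_wt w = nu.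

Lemma free_comp_homogeneous mu nu x : homogeneous mu x ->
  free_comp nu x = if mu == nu then x else 0.
Proof.
move=> xmu; apply/malgP => w; rewrite free_compE.
have [x0|/xmu ->] := eqVneq (x@_w) 0; last by case: ifP; rewrite // mcoeff0.
by rewrite x0 if_same; case: ifP; rewrite ?x0 // mcoeff0.
Qed.

Lemma homogeneousU w c : homogeneous (word_wt w) << c *g w >>.
Proof.
by move=> v; rewrite mcoeffU; case: (eqVneq w v) => [->//|_]; rewrite eqxx.
Qed.

Lemma homogeneousD nu x y :
  homogeneous nu x -> homogeneous nu y -> homogeneous nu (x + y).
Proof.
move=> hx hy w; rewrite mcoeffD.
by have [->|/hx//] := eqVneq (x@_w) 0; rewrite add0r => /hy.
Qed.

Lemma homogeneous_sum nu (T : Type) (s : seq T) (P : pred T) (F : T -> FA) :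
  (forall t, P t -> homogeneous nu (F t)) -> homogeneous nu (\sum_(t <- s | P t) F t).
Proof.
move=> hF; elim/big_ind: _ => //; last exact: homogeneousD.
by move=> w; rewrite mcoeff0 eqxx.
Qed.

Lemma homogeneousZ nu c x : homogeneous nu x -> homogeneous nu (c *: x).
Proof.
by move=> hx w; rewrite mcoeffZ mulf_eq0 negb_or => /andP[_ /hx].
Qed.

Lemma homogeneousM mu nu x y : homogeneous mu x -> homogeneous nu y ->
  homogeneous [ffun i => (mu i + nu i)%N] (x * y).
Proof.
move=> hx hy; rewrite [x]monalgE [y]monalgE mulr_suml big_seq.
apply: homogeneous_sum => u; rewrite -mcoeff_neq0 => /hx <-.
rewrite mulr_sumr big_seq; apply: homogeneous_sum => v.
rewrite -mcoeff_neq0 => /hy <-; rewrite free_mulU.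
by rewrite -word_wt_cat -fmM; exact: homogeneousU.
Qed.

Lemma homogeneous1 : homogeneous [ffun=> 0%N] 1.
Proof.
have -> : [ffun=> 0%N] = word_wt (mone : {fmonom I}).
  by apply/ffunP => i; rewrite !ffunE fm1.
exact: homogeneousU.
Qed.

Lemma homogeneousX mu x n : homogeneous mu x ->
  homogeneous [ffun i => (n * mu i)%N] (x ^+ n).
Proof.
move=> hx; elim: n => [|n IHn].
  have -> : [ffun i => (0 * mu i)%N] = [ffun=> 0%N] :> weight.
    by apply/ffunP => i; rewrite !ffunE.
  exact: homogeneous1.
rewrite exprS; have := homogeneousM hx IHn; congr homogeneous.
by apply/ffunP => i; rewrite !ffunE mulSn.
Qed.

Lemma homogeneous_gen i : homogeneous (alpha i) (free_gen i).
Proof.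
have -> : alpha i = word_wt (fmu i).
  by apply/ffunP => j; rewrite !ffunE fmU /= addn0.
exact: homogeneousU.
Qed.

(** The exponents of the two divided powers of the i-th generator have a constant sum, so all
    summands share one weight. *)
Lemma homogeneous_serre i j : homogeneous
  [ffun k => (`|1 - A i j| * alpha i k + alpha j k)%N]
  (serre_rel A (@free_gen I) i j).
Proof.
apply: homogeneous_sum => p _; apply: homogeneousZ.
have hX k n : homogeneous [ffun l => (n * alpha k l)%N] (divpow (free_gen k) n).
  exact/homogeneousZ/homogeneousX/homogeneous_gen.
have := homogeneousM (homogeneousM (hX i p) (@homogeneous_gen j))
                     (hX i (`|1 - A i j| - p)%N).
congr homogeneous; apply/ffunP => k; rewrite !ffunE addnAC -mulnDl.
by rewrite subnKC // -ltnS.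
Qed.

Lemma free_mul3E (x y z : FA) : x * y * z = \sum_(u <- msupp x)
  \sum_(v <- msupp z) << x@_u *g u >> * y * << z@_v *g v >>.
Proof.
transitivity (\sum_(u <- msupp x) << x@_u *g u >> * y * z).
  by rewrite -mulr_suml -mulr_suml -monalgE.
by apply: eq_bigr => u _; rewrite -mulr_sumr -monalgE.
Qed.

(** The ideal is graded: once the outer factors are split into monomials, every term is homogeneous,
    and the projection keeps it or kills it. *)
Lemma serre_pred_free_comp nu x :
  x \in serre_pred A -> free_comp nu x \in serre_pred A.
Proof.
move=> /serre_predP[s /allP hs ->]; rewrite raddf_sum big_seq rpred_sum //= => t ts.
rewrite free_mul3E raddf_sum rpred_sum //= => u _.
rewrite raddf_sum rpred_sum //= => v _.
rewrite (free_comp_homogeneous nu (homogeneousM (homogeneousM (@homogeneousU _ _)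
  (@homogeneous_serre _ _)) (@homogeneousU _ _))).
case: ifP => _; last exact: rpred0.
exact/serre_predMr/serre_predMl/serre_pred_serre/hs.
Qed.

(** [free_comp] descended to f. It gives the uniqueness of the weight of a basis element and the
    bound on [basis_phi]. *)
Definition wproj nu (x : falg A) : falg A := fpi A (free_comp nu (frepr x)).

Lemma wproj_pi nu x : wproj nu (fpi A x) = fpi A (free_comp nu x).
Proof. by apply/fpi_eq; rewrite -raddfB; apply/serre_pred_free_comp/frepr_pi. Qed.

Lemma wproj_linear nu : linear (wproj nu).
Proof.
move=> c x y; have [{}x ->] := fpi_surj x; have [{}y ->] := fpi_surj y.
by rewrite -linearP !wproj_pi -linearP -linearP.
Qed.
HB.instance Definition _ nu := GRing.isLinear.Build rat (falg A) (falg A) *:%R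
  (wproj nu) (wproj_linear nu).

Lemma wproj_theta mu nu i x : nu = [ffun j => (alpha i j + mu j)%N] ->
  wproj nu (theta A i * x) = theta A i * wproj mu x.
Proof.
move=> ->; have [{}x ->] := fpi_surj x.
rewrite [in RHS]wproj_pi -!rmorphM wproj_pi; congr (fpi _ _).
rewrite [x]monalgE mulr_sumr !raddf_sum mulr_sumr; apply: eq_bigr => w _ /=.
rewrite free_mulU mul1r !free_compU fmM word_wt_cat fmU /=.
have -> : [ffun j => (word_wt [:: i] j + word_wt w j)%N] =
          [ffun j => (alpha i j + word_wt w j)%N].
  by apply/ffunP => j; rewrite !ffunE /= addn0.
have -> : ([ffun j => (alpha i j + word_wt w j)%N] ==
           [ffun j => (alpha i j + mu j)%N]) = (word_wt w == mu).
  apply/eqP/eqP => [/ffunP wmu|->//]; apply/ffunP => j.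
  by have := wmu j; rewrite ![LHS]ffunE ![RHS]ffunE => /addnI.
by case: ifP => _; rewrite ?free_mulU ?mul1r // mulr0.
Qed.

Lemma wproj_theta0 nu i x : nu i = 0%N -> wproj nu (theta A i * x) = 0.
Proof.
move=> nui; have [{}x ->] := fpi_surj x.
rewrite -rmorphM wproj_pi -(raddf0 (fpi A)); congr (fpi _ _).
rewrite [x]monalgE mulr_sumr raddf_sum big1 // => w _ /=.
rewrite free_mulU mul1r free_compU fmM fmU; case: eqP => // wnu.
by move: nui; rewrite -wnu ffunE /= eqxx.
Qed.

Lemma wproj_word nu (w : seq I) : wproj nu (\prod_(i <- w) theta A i) =
  if word_wt w == nu then \prod_(i <- w) theta A i else 0.
Proof.
have -> : \prod_(i <- w) theta A i = fpi A << FMonom w >>.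
  elim: w => [|i w IHw].
    by rewrite big_nil -(rmorph1 (fpi A)); congr fpi; apply/malgP => v;
       rewrite mcoeff1 mcoeffU1 -!(inj_eq val_inj) /= fm1 eq_sym.
  rewrite big_cons IHw -rmorphM /= free_mulU mulr1; congr (fpi _ << _ *g _ >>).
  by apply/val_inj; rewrite /= fmM fmU.
by rewrite wproj_pi free_compU /=; case: ifP => // _; rewrite raddf0.
Qed.

Lemma wproj_thetaX mu nu i n x : nu = [ffun j => (n * alpha i j + mu j)%N] ->
  wproj nu (theta A i ^+ n * x) = theta A i ^+ n * wproj mu x.
Proof.
elim: n nu => [|n IHn] nu ->.
  rewrite !mul1r; congr wproj; by apply/ffunP => j; rewrite ffunE.
rewrite !exprS -!mulrA (wproj_theta (mu := [ffun j => (n * alpha i j + mu j)%N])).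
  by rewrite IHn.
by apply/ffunP => j; rewrite !ffunE mulSn addnA.
Qed.

(** Every monomial in theta_i^n f contains the letter i at least n times. *)
Lemma wproj_thetaX0 nu i n x : (nu i < n)%N -> wproj nu (theta A i ^+ n * x) = 0.
Proof.
elim: n nu => [//|n IHn] nu nun; rewrite exprS -mulrA.
case nui: (nu i) nun => [|m] nun; first exact: wproj_theta0.
(* The truncated subtraction is exact: alpha_i is nonzero only at i, where nu is positive. *)
rewrite (wproj_theta (mu := [ffun j => (nu j - alpha i j)%N])).
  by rewrite IHn ?mulr0 // !ffunE eqxx nui subn1.
apply/ffunP => j; rewrite !ffunE.
by case: eqP => [<-|_]; rewrite ?nui ?subn1 // subn0.
Qed.

End Grading.

(** * The string order on a lowest weight crystal *)

Section LowestWeightCrystal.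
Variable I : finType.

Definition height (nu : {ffun I -> nat}) : nat := \sum_i nu i.

(** The properties of the crystal of a basis on which the order theory rests. They leave the
    involution free, so that it can later be replaced by the identity. *)
Record lowest_weight_crystal (X : crystal I) : Prop := {
  lw_phi_e : forall i (x : X), cr_phi i (cr_e i x) = (cr_phi i x).+1;
  lw_fP : forall i (x y : X), cr_f i x = Some y <-> cr_e i y = x;
  lw_f0 : forall i (x : X), cr_f i x = None -> cr_phi i x = 0%N;
  lw_height_e : forall i (x : X),
    height (cr_wt (cr_e i x)) = (height (cr_wt x)).+1;
  lw_height_lowest : forall x : X,
    (forall i, cr_phi i x = 0%N) -> height (cr_wt x) = 0%N;
  lw_lowest_unique : forall x y : X,
    (forall i, cr_phi i x = 0%N) -> (forall i, cr_phi i y = 0%N) -> x = y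
}.

Lemma lowest_weight_crystal_iso (X Y : crystal I) (h : X -> Y) :
  crystal_iso h -> lowest_weight_crystal Y -> lowest_weight_crystal X.
Proof.
case=> hbij hwt hphi he hf [Yphi YfP Yf0 Yhe Yhl Yu].
have hinj := bij_inj hbij.
split.
- by move=> i x; rewrite -!hphi -he Yphi.
- move=> i x y; split.
    by move=> fx; apply: hinj; rewrite -he; apply/YfP; rewrite hf fx.
  move=> <-; have /YfP := he i y.
  by rewrite hf; case: (cr_f _ _) => //= z [/hinj ->].
- by move=> i x fx; rewrite -hphi; apply: Yf0; rewrite hf fx.
- by move=> i x; rewrite -!hwt -he Yhe.
- by move=> x x0; rewrite -hwt; apply: Yhl => i; rewrite hphi.
- by move=> x y x0 y0; apply: hinj; apply: Yu => i; rewrite hphi.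
Qed.

Section Theory.
Variables (X : crystal I) (hX : lowest_weight_crystal X).
Implicit Types x y z : X.

Lemma lw_f_e i x : cr_f i (cr_e i x) = Some x.
Proof. exact/(lw_fP hX). Qed.

Lemma lw_phi_gt0 i x : (0 < cr_phi i x)%N -> exists y, cr_e i y = x.
Proof.
move=> x0; case fx: (cr_f i x) => [y|]; first by exists y; apply/(lw_fP hX).
by move: x0; rewrite (lw_f0 hX fx).
Qed.

(** Induction on the height of the weight: an element with some phi_i positive is e_i of an element
    of smaller height. *)
Lemma lw_ind (P : X -> Prop) :
  (forall x, (forall i, cr_phi i x = 0%N) -> P x) ->
  (forall i x, P x -> P (cr_e i x)) -> forall x, P x.
Proof.
move=> P0 Pe x; have [n] := ubnP (height (cr_wt x)).
elim: n x => // n IHn x xn.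
have [x0|/existsNP[i]] := pselect (forall i, cr_phi i x = 0%N); first exact: P0.
move/eqP; rewrite -lt0n => /lw_phi_gt0[y yx].
rewrite -yx; apply/Pe/IHn; rewrite -ltnS; apply: leq_trans xn.
by rewrite -yx (lw_height_e hX).
Qed.

(** The length of the word is fixed by the weight, whence the finiteness of weight spaces. *)
Lemma lw_spell x : exists2 w : seq I, size w = height (cr_wt x) &
  exists2 x0 : X, (forall i, cr_phi i x0 = 0%N) & x = foldr (@cr_e I X) x0 w.
Proof.
move: x; apply: lw_ind => [x x0|i x [w sw [x0 x00 xw]]].
  by exists [::]; [rewrite (lw_height_lowest hX) | exists x].
by exists (i :: w); [rewrite /= sw (lw_height_e hX) | exists x0; rewrite //= xw].
Qed.

Lemma lw_pigeonhole (nu : {ffun I -> nat}) (u : nat -> X) :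
  (forall n, cr_wt (u n) = nu) -> exists m n, (m < n)%N /\ u m = u n.
Proof.
move=> unu.
have spell n : exists w : (height nu).-tuple I,
    exists2 x0 : X, (forall i, cr_phi i x0 = 0%N) & u n = foldr (@cr_e I X) x0 w.
  have [w sw xw] := lw_spell (u n); have sw' : size w == height nu.
    by rewrite sw unu.
  by exists (Tuple sw').
have [g gP] := choice spell.
(* One more index than there are words; a repeated word gives a repeated element because the lowest
   element is unique. *)
have : ~ injective (fun k : 'I_(#|{: (height nu).-tuple I}|.+1) => g k).
  by move=> /leq_card; rewrite card_ord ltnn.
move=> /existsNP[m /existsNP[n /not_implyP[gmn mn]]].
have umn : u m = u n.
  have [x x0 ->] := gP m; have [y y0 ->] := gP n.
  by rewrite gmn (lw_lowest_unique hX x0 y0).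
case: (ltngtP m n) => [lmn|lnm|emn]; [by exists m, n|by exists n, m|].
by case: mn; apply: val_inj.
Qed.

(** [le_str] compares weights only at the start of a chain; this is the part of it that propagates
    along [approx]. *)
Definition phi_dominated x y := forall c,
  clos_refl_trans (X * X) (@approx I X) (x, y) c ->
  forall i, (cr_phi i c.1 <= cr_phi i c.2)%N.

Lemma phi_dominated_step x y c :
  phi_dominated x y -> approx (x, y) c -> phi_dominated c.1 c.2.
Proof.
move=> xy xyc d cd i; apply: xy; apply: rt_trans (rt_step _ _ _ _ xyc) _.
by case: c cd {xyc}.
Qed.

(** Coinduction principle: [phi_dominated] is the largest relation that implies the inequalities on
    phi and is stable under [approx]. *)
Lemma phi_dominated_sub (P : X -> X -> Prop) :
  (forall x y, P x y -> forall i, (cr_phi i x <= cr_phi i y)%N) ->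
  (forall x y c, P x y -> approx (x, y) c -> P c.1 c.2) ->
  forall x y, P x y -> phi_dominated x y.
Proof.
move=> Pphi Papprox x y Pxy c xyc; apply: Pphi.
have : P (x, y).1 (x, y).2 -> P c.1 c.2; last by apply.
by elim: xyc => [b d bd Pb|//|b d e _ bd _ de /bd/de//]; apply: Papprox Pb _; case: b bd.
Qed.

Lemma phi_dominated_refl x : phi_dominated x x.
Proof.
apply: (phi_dominated_sub (P := eq)) => // [{}x _ <- //|{}x _ [c d] <-].
case=> /= [[i [_ [-> ->]]]|[i [_ _ -> [//]]]|[-> ->]] //.
Qed.

(** Coinduction on the composite of the relation with itself. *)
Lemma phi_dominated_trans x y z :
  phi_dominated x y -> phi_dominated y z -> phi_dominated x z.
Proof.
move=> xy yz.
apply: (phi_dominated_sub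
  (P := fun x z => exists2 y, phi_dominated x y & phi_dominated y z)); last by exists y.
  move=> {}x {}z [{xy yz}y xy yz] i.
  exact: leq_trans (xy _ (rt_refl _ _ _) i) (yz _ (rt_refl _ _ _) i).
move=> {}x {}z [c d] [{xy yz}y xy yz].
(* phi_i x <= phi_i y <= phi_i z, so y follows every step of (x, z). *)
have sandwich i : cr_phi i x = cr_phi i z -> cr_phi i x = cr_phi i y.
  move=> xz; apply/eqP; rewrite eqn_leq (xy _ (rt_refl _ _ _)) /= xz.
  exact: (yz _ (rt_refl _ _ _)).
case=> /= [[i [xz [-> ->]]]|[i [xz z0 fx fz]]|[-> ->]].
- exists (cr_e i y).
    apply: (phi_dominated_step (c := (_, _)) xy); apply: Or31.
    by exists i; rewrite /= (sandwich i xz).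
  apply: (phi_dominated_step (c := (_, _)) yz); apply: Or31.
  by exists i; rewrite /= -(sandwich i xz).
- have y0 : (0 < cr_phi i y)%N by rewrite -(sandwich i xz) xz.
  have [y' /(lw_fP hX) fy] := lw_phi_gt0 y0.
  exists y'.
    apply: (phi_dominated_step (c := (_, _)) xy); apply: Or32.
    by exists i; split => //=; exact: sandwich.
  apply: (phi_dominated_step (c := (_, _)) yz); apply: Or32.
  by exists i; split => //=; rewrite -(sandwich i xz).
- exists (cr_sigma y).
    by apply: (phi_dominated_step (c := (_, _)) xy); apply: Or33.
  by apply: (phi_dominated_step (c := (_, _)) yz); apply: Or33.
Qed.

(** Mutual domination equates all phi_i. If x is lowest, so is y; otherwise some f_i is defined at
    both, and the step along f_i reduces to a smaller height. *)
Lemma phi_dominated_antisym x y :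
  phi_dominated x y -> phi_dominated y x -> x = y.
Proof.
move: x y; apply: lw_ind => [x x0|i x IHx] y xy yx.
  apply: (lw_lowest_unique hX x0) => i; apply/eqP; rewrite -leqn0 -(x0 i).
  exact: (yx _ (rt_refl _ _ _)).
have e_phi : cr_phi i (cr_e i x) = cr_phi i y.
  by apply/eqP; rewrite eqn_leq (xy _ (rt_refl _ _ _)) (yx _ (rt_refl _ _ _)).
have y0 : (0 < cr_phi i y)%N by rewrite -e_phi (lw_phi_e hX).
have [y' ey] := lw_phi_gt0 y0; rewrite -ey; congr cr_e.
apply: IHx.
  apply: (phi_dominated_step (c := (_, _)) xy); apply: Or32.
  by exists i; split => //=; rewrite -?ey lw_f_e.
apply: (phi_dominated_step (c := (_, _)) yx); apply: Or32.
by exists i; split => //=; rewrite -?ey ?lw_f_e ?(lw_phi_e hX).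
Qed.

Lemma le_str_order : Relation_Definitions.order X (@le_str I X).
Proof.
split.
- by move=> x; split=> //; exact: phi_dominated_refl.
- move=> x y z [xy hxy] [yz hyz]; split; first by rewrite xy.
  exact: phi_dominated_trans hxy hyz.
- by move=> x y [_ xy] [_ yx]; exact: phi_dominated_antisym xy yx.
Qed.

(* By finiteness of weight spaces, x <= h x <= h (h x) <= ... closes up. *)
Lemma le_str_inj_id (h : X -> X) :
  injective h -> (forall x, le_str x (h x)) -> h =1 id.
Proof.
move=> hinj hle x; have [rfl trn anti] := le_str_order.
have le_iter n y : le_str y (iter n h y).
  by elim: n => [|n IHn]; [exact: rfl|apply: trn IHn _; exact: hle].
have [|m [n [mn]]] := @lw_pigeonhole (cr_wt x) (fun n => iter n h x).
  by move=> n; case: (le_iter n x).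
have iter_inj k : injective (iter k h) by elim: k => [|k IHk] y z // /hinj/IHk.
(* Cancelling the first m iterations leaves x = h^(k+1) x with k = n - m - 1, hence h x is below h^k
   (h x) = x. *)
rewrite -(subnKC mn) addSnnS iterD => /iter_inj xn.
apply: anti; last exact: hle.
by rewrite [x in le_str _ x]xn iterSr; exact: le_iter.
Qed.

End Theory.
End LowestWeightCrystal.

(** * Coordinates in a basis *)

Section LinearCombinations.
Variable F : lmodType rat.
Implicit Types (c d : {malg rat[F]}) (x y b : F) (S B : set F).

(** Allows combinations with different supports to be summed over one common finite set. *)
Lemma combinationEw (e : {fset F}) c : (msupp c `<=` e)%fset ->
  combination c = \sum_(x <- e) c@_x *: x.
Proof.
by move=> ce; apply: big_fset_incl => // x _ xc; rewrite mcoeff_outdom ?scale0r.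
Qed.

Lemma combination_linear : linear (@combination F).
Proof.
move=> a c d; pose e := (msupp c `|` msupp d)%fset.
have ce : (msupp c `<=` e)%fset := fsubsetUl _ _.
have de : (msupp d `<=` e)%fset := fsubsetUr _ _.
rewrite (combinationEw ce) (combinationEw de) (@combinationEw e).
  rewrite scaler_sumr -big_split /=; apply: eq_bigr => x _.
  by rewrite mcoeffD mcoeffZ scalerDl scalerA.
by apply: fsubset_trans (msuppD_le _ _) _; apply: fsetSU; exact: msuppZ_le.
Qed.
HB.instance Definition _ := GRing.isLinear.Build rat {malg rat[F]} F *:%R
  (@combination F) combination_linear.

Lemma combinationU a x : combination << a *g x >> = a *: x.
Proof. by rewrite (combinationEw (msuppU_le)) big_seq_fset1 mcoeffUU. Qed.

Lemma supportedP S c : supported S c <-> (forall x, c@_x != 0 -> S x).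
Proof. by split=> Sc x; [rewrite mcoeff_neq0|rewrite -mcoeff_neq0] => /Sc. Qed.

Lemma supportedZD S a c d :
  supported S c -> supported S d -> supported S (a *: c + d).
Proof.
move=> /supportedP Sc /supportedP Sd; apply/supportedP => x.
rewrite mcoeffD mcoeffZ; have [->|/Sc//] := eqVneq (c@_x) 0.
by rewrite mulr0 add0r => /Sd.
Qed.

Section Basis.
Variables (B : set F) (hB : is_basis B).

(** Independence makes the family chosen by [xget] in [coef] the only candidate. *)
Lemma coef_combination c b : supported B c -> coef B b (combination c) = c@_b.
Proof.
move=> Bc; rewrite /coef; congr (_@_b); apply: xget_unique => // d [Bd dc].
apply/eqP; rewrite -subr_eq0; apply/eqP; apply: hB.1.
  by rewrite addrC -scaleN1r; exact: supportedZD.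
by rewrite raddfB /= dc subrr.
Qed.

Lemma basis_combination x : exists2 c, supported B c & combination c = x.
Proof. by have : Defs.span B x by rewrite hB.2. Qed.

Lemma coefP b a x y : coef B b (a *: x + y) = a * coef B b x + coef B b y.
Proof.
have [c Bc <-] := basis_combination x; have [d Bd <-] := basis_combination y.
by rewrite -linearP !coef_combination // ?mcoeffD ?mcoeffZ //; exact: supportedZD.
Qed.

Lemma coef0 b : coef B b 0 = 0.
Proof.
by rewrite -[X in coef _ _ X](raddf0 (@combination F)) coef_combination ?mcoeff0 // => x;
  rewrite msupp0.
Qed.

Lemma coefZ b a x : coef B b (a *: x) = a * coef B b x.
Proof. by rewrite -[a *: x]addr0 coefP coef0 addr0. Qed.

Lemma coefD b x y : coef B b (x + y) = coef B b x + coef B b y.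
Proof. by rewrite -[x]scale1r coefP mul1r scale1r. Qed.

Lemma coefB b x y : coef B b (x - y) = coef B b x - coef B b y.
Proof. by rewrite coefD -scaleN1r coefZ mulN1r. Qed.

Lemma coef_basis b x : B x -> coef B b x = (x == b)%:R.
Proof.
move=> Bx; rewrite -{1}[x]scale1r -combinationU coef_combination ?mcoeffU //.
by move=> y /(fsubsetP msuppU_le); rewrite in_fset1 => /eqP ->.
Qed.

Lemma basis_linear_ind (P : F -> Prop) : P 0 ->
  (forall a x y, B x -> P y -> P (a *: x + y)) -> forall x, P x.
Proof.
move=> P0 PD x; have [c Bc <-] := basis_combination x.
rewrite /combination big_seq; elim/big_rec: _ => // y z /Bc By Pz.
exact: PD.
Qed.

Lemma span_subsetP S x : (S `<=` B)%classic ->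
  Defs.span S x <-> (forall b, coef B b x != 0 -> S b).
Proof.
move=> SB; split=> [[c Sc <-] b|Sx].
  rewrite coef_combination; last by move=> y /Sc/SB.
  by move: b; apply/supportedP.
have [c Bc cx] := basis_combination x; exists c => //.
by apply/supportedP => b; rewrite -coef_combination // cx => /Sx.
Qed.

End Basis.
End LinearCombinations.

(** * The crystal of a basis of canonical type *)

Section RightIdeals.
Variables (I : finType) (A : I -> I -> int).
Implicit Types (i : I) (x y : falg A).

Lemma right_idealX i p x : right_ideal i p (theta A i ^+ p * x).
Proof. by exists x. Qed.

Lemma right_ideal0 i x : right_ideal i 0 x.
Proof. by rewrite -[x]mul1r; exact: right_idealX. Qed.

Lemma right_ideal_le i p q x : (q <= p)%N -> right_ideal i p x -> right_ideal i q x.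
Proof.
move=> qp [y _ <-].
by rewrite -(subnKC qp) (exprD _ q) -mulrA; exact: right_idealX.
Qed.

Lemma right_idealZD i p (a : rat) x y :
  right_ideal i p x -> right_ideal i p y -> right_ideal i p (a *: x + y).
Proof.
move=> [x' _ <-] [y' _ <-]; rewrite scalerAr -mulrDr; exact: right_idealX.
Qed.

Lemma right_ideal_zero i p : right_ideal i p (0 : falg A).
Proof. by rewrite -(mulr0 (theta A i ^+ p)); exact: right_idealX. Qed.

Lemma right_idealZ i p (a : rat) x : right_ideal i p x -> right_ideal i p (a *: x).
Proof. by move=> Rx; rewrite -[_ *: _]addr0; exact/right_idealZD/right_ideal_zero. Qed.

Lemma right_ideal_theta_div i n p x :
  right_ideal i p x -> right_ideal i (n + p) (theta_div A i n * x).
Proof.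
move=> [y _ <-]; rewrite /theta_div /divpow -scalerAl; apply: right_idealZ.
rewrite mulrA -(exprD _ n); exact: right_idealX.
Qed.

Lemma wproj_weight_space mu nu x : weight_space nu x ->
  wproj mu x = if nu == mu then x else 0.
Proof.
move=> [c Sc <-]; rewrite /combination big_seq.
elim/big_rec: _ => [|y z /Sc[w wnu /= <-] IHz]; first by rewrite raddf0 if_same.
have {}wnu : word_wt w = nu by apply/ffunP => i; rewrite ffunE.
rewrite wproj_linear IHz wproj_word wnu.
by case: eqVneq => _; rewrite // scaler0 addr0.
Qed.

(** Reflects that f is the sum of the scalars and of the right ideals theta_i f: a nonempty word
    begins with some theta_i. *)
Lemma falg_word_ind (P : falg A -> Prop) :
  (forall a : rat, P (a *: 1)) -> (forall i x, P (theta A i * x)) ->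
  (forall x y, P x -> P y -> P (x + y)) -> forall x, P x.
Proof.
move=> P1 Pt PD x; have [{}x ->] := fpi_surj x.
rewrite [x]monalgE raddf_sum /=; elim/big_rec: _ => [|w y _ Py].
  by rewrite -(scale0r 1); exact: P1.
apply: PD => //; have -> : << x@_w *g w >> = x@_w *: (<< w >> : free_alg I).
  by rewrite -mul_malgC free_mulU mulr1 mul1m.
rewrite linearZ /=; case: w => -[|i w].
  have -> : << FMonom [::] >> = 1 :> free_alg I.
    by congr << _ >>; apply/val_inj; rewrite /= fm1.
  by rewrite rmorph1; exact: P1.
have -> : << FMonom (i :: w) >> = free_gen i * << FMonom w >>.
  rewrite free_mulU mulr1; congr << _ >>; apply/val_inj.
  by rewrite /= fmM fmU.
rewrite rmorphM scalerAr; exact: Pt.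
Qed.

End RightIdeals.

(** * Coefficients on a basis of canonical type: right ideals, weights, divided powers *)

Section CanonicalBasis.
Variables (I : finType) (A : I -> I -> int) (B : set (falg A)).
Hypothesis hB : canonical_type B.
Let basisB : is_basis B := ct_basis hB.
Implicit Types (i : I) (b c : B) (x y : falg A) (n p : nat).

Lemma coef_val b c : coef B (val b) (val c) = (c == b)%:R.
Proof. rewrite (coef_basis basisB); last exact: set_valP.
by rewrite (inj_eq val_inj). Qed.

Lemma coef_neq0 x y : coef B y x != 0 -> B y.
Proof.
have [c Bc <-] := basis_combination basisB x.
by rewrite (coef_combination basisB) //; move: y; apply/supportedP.
Qed.

(** The right ideal is spanned by a part S of B, and S can only consist of the elements of B lying
    in the ideal. *)
Lemma right_ideal_coef i p x :
  right_ideal i p x <->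
  (forall b, coef B (val b) x != 0 -> right_ideal i p (val b)).
Proof.
have [S SB RS] := ct_right_ideal hB i p; rewrite RS (span_subsetP basisB _ SB).
(* By independence, an element of B in the span of S belongs to S. *)
have SE b : S (val b) <-> Defs.span S (val b).
  rewrite (span_subsetP basisB _ SB); split=> [Sb y|]; last first.
    by apply; rewrite coef_val eqxx oner_neq0.
  rewrite (coef_basis basisB); last exact: SB.
  by case: (_ =P y) => [<-|_]; rewrite ?eqxx.
split=> [Sx b /Sx/SE//|Sx y yx].
have By := coef_neq0 yx.
by have /SE := Sx (SigSub (mem_set By)) yx.
Qed.

Lemma coef_right_ideal i p b x :
  right_ideal i p x -> ~ right_ideal i p (val b) -> coef B (val b) x = 0.
Proof.
move=> /right_ideal_coef Rx Rb.
by have [//|/Rx/Rb[]] := eqVneq (coef B (val b) x) 0.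
Qed.

Lemma val_neq0 b : val b != 0.
Proof.
apply/eqP => b0; have := coef_val b b; rewrite b0 (coef0 basisB) eqxx.
by move/eqP; rewrite eq_sym oner_eq0.
Qed.

Lemma basis_wtP b : weight_space (basis_wt b) (val b).
Proof. exact: xgetPex (ct_weight hB (set_valP b)). Qed.

Lemma wproj_basis mu b :
  wproj mu (val b) = if basis_wt b == mu then val b else 0.
Proof. exact: wproj_weight_space (basis_wtP b). Qed.

(** The elements of B are weight vectors, so the weight projection is diagonal in B. *)
Lemma coef_wproj mu b x : coef B (val b) (wproj mu x) =
  if basis_wt b == mu then coef B (val b) x else 0.
Proof.
elim/(basis_linear_ind basisB): x => [|a x y Bx IHy].
  by rewrite raddf0 (coef0 basisB) if_same.
rewrite wproj_linear !(coefP basisB) IHy.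
have [c ->] : exists c, x = val c by exists (SigSub (mem_set Bx)).
rewrite wproj_basis; case: eqP => [cmu|cmu]; case: eqP => [bmu|bmu] //.
- rewrite addr0 coef_val; case: (c =P b) => [cb|_]; last by rewrite mulr0.
  by case: bmu; rewrite -cb.
- rewrite (coef0 basisB) coef_val; case: (c =P b) => [cb|//].
  by case: cmu; rewrite cb.
- by rewrite (coef0 basisB) mulr0 addr0.
Qed.

Lemma basis_wt_unique b nu : wproj nu (val b) != 0 -> basis_wt b = nu.
Proof. by rewrite wproj_basis; case: (_ =P nu) => // _; rewrite eqxx. Qed.

(** The maximum defining [basis_phi] exists: 0 is always admissible, and the admissible exponents
    are bounded by the i-th coordinate of the weight. *)
Lemma basis_phiP i p b : right_ideal i p (val b) <-> (p <= basis_phi i b)%N.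
Proof.
have Rwt q : right_ideal i q (val b) -> (q <= basis_wt b i)%N.
  case=> y _ yb; rewrite leqNgt; apply/negP => lt_q.
  have wb : wproj (basis_wt b) (val b) = val b by rewrite wproj_basis eqxx.
  by have := val_neq0 b; rewrite -wb -yb wproj_thetaX0 ?eqxx.
have exR : exists q, `[< right_ideal i q (val b) >].
  by exists 0%N; apply/asboolP; exact: right_ideal0.
have leR q : `[< right_ideal i q (val b) >] -> (q <= basis_wt b i)%N.
  by move/asboolP; exact: Rwt.
have exphi : exists q, right_ideal i q (val b) /\
    forall r, right_ideal i r (val b) -> (r <= q)%N.
  case: (ex_maxnP exR leR) => q /asboolP Rq qmax.
  by exists q; split=> // r Rr; apply/qmax/asboolP.
have [Rphi phimax] : right_ideal i (basis_phi i b) (val b) /\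
  forall q, right_ideal i q (val b) -> (q <= basis_phi i b)%N := xgetPex 0%N exphi.
by split=> [/phimax//|/right_ideal_le]; apply.
Qed.

Lemma coef_phi i b x : right_ideal i (basis_phi i b).+1 x -> coef B (val b) x = 0.
Proof. by move=> /coef_right_ideal; apply => /basis_phiP; rewrite ltnn. Qed.

(** Modulo theta_i^(n+1) f, multiplication by the divided power of theta_i carries the basis of f /
    theta_i f bijectively onto that of the n-th quotient and b0 to b; the coefficient of b ignores
    theta_i^(n+1) f. *)
Lemma string_coef i n b0 b x : basis_e_string i n b0 b ->
  coef B (val b) (theta_div A i n * x) = coef B (val b0) x.
Proof.
case=> phi0 phib Rb; have [pi [[piB pi_inj _] piR]] := ct_permutation hB i n.
have Bphi0 c : (B `\` right_ideal i 1)%classic (val c) <-> basis_phi i c = 0%N.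
  split=> [[_ Rc]|c0]; first by apply/eqP; rewrite -leqn0 leqNgt; apply/negP => /basis_phiP.
  by split; [exact: set_valP|move=> /basis_phiP; rewrite c0].
have coef_pi c : basis_phi i c = 0%N ->
    coef B (val b) (theta_div A i n * val c) = (pi (val c) == val b)%:R.
  move=> c0; have /piB[[Bpi _] _] := (Bphi0 c).2 c0.
  rewrite -(coef_basis basisB _ Bpi); apply/eqP.
  rewrite -subr_eq0 -(coefB basisB) (coef_phi (i := i)) // phib.
  exact/piR/Bphi0.
(* The coefficient of b in the product with b0 is 1 by the string condition and 0 or 1 by [coef_pi],
   according to whether pi b0 is b. *)
have bE : pi (val b0) = val b.
  have := coef_pi _ phi0; have : coef B (val b) (val b - theta_div A i n * val b0) = 0.
    by apply: (coef_phi (i := i)); rewrite phib.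
  rewrite (coefB basisB) coef_val eqxx => /eqP; rewrite subr_eq0 => /eqP <-.
  by case: eqP => // _ /eqP; rewrite oner_eq0.
elim/(basis_linear_ind basisB): x => [|a x y Bx IHy].
  by rewrite mulr0 !(coef0 basisB).
have -> : theta_div A i n * (a *: x + y) =
    a *: (theta_div A i n * x) + theta_div A i n * y by rewrite mulrDr scalerAr.
rewrite (coefP basisB (val b) a (theta_div A i n * x)) (coefP basisB (val b0) a x) [X in _ + X]IHy.
suff -> : coef B (val b) (theta_div A i n * x) = coef B (val b0) x by [].
have [c ->] : exists c, x = val c by exists (SigSub (mem_set Bx)).
(* Either c survives in f / theta_i f and injectivity of pi decides, or c lies in theta_i f and both
   coefficients vanish. *)
case c0: (basis_phi i c) => [|m].
  rewrite coef_pi // coef_val -bE; congr (_%:R); congr nat_of_bool.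
  by rewrite -(inj_eq val_inj); apply/eqP/eqP => [|-> //]; apply: pi_inj; apply/mem_set/Bphi0.
rewrite coef_val; case: eqP => [cb|_]; first by rewrite -cb c0 in phi0.
apply: (coef_phi (i := i)); rewrite phib -addn1; apply: right_ideal_theta_div.
by apply/basis_phiP; rewrite c0.
Qed.

End CanonicalBasis.

(** * Strings in a basis of canonical type and the crystal they define *)

Section Strings.
Variables (I : finType) (A : I -> I -> int) (B : set (falg A)).
Hypothesis hB : canonical_type B.
Let basisB : is_basis B := ct_basis hB.
Implicit Types (i : I) (b c : B) (x y : falg A) (n p : nat).

Lemma string_coef_congr i n b0 b x y : basis_e_string i n b0 b ->
  right_ideal i n.+1 (x - y) -> coef B (val b) x = coef B (val b) y.
Proof.
case=> _ phib _ Rxy; apply/eqP; rewrite -subr_eq0 -(coefB basisB); apply/eqP.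
by apply: (coef_phi hB (i := i)); rewrite phib.
Qed.

(** The coefficient of b in c equals that of b0 in c0, and both are Kronecker symbols. *)
Lemma string_val_eq i n b0 c0 b c : basis_e_string i n b0 b ->
  basis_e_string i n c0 c -> (c == b) = (c0 == b0).
Proof.
move=> sb sc; have [_ _ Rc] := sc.
have := string_coef_congr sb Rc.
rewrite (string_coef hB _ sb) !(coef_val hB) => /eqP.
by rewrite eqr_nat; case: (c == b); case: (c0 == b0).
Qed.

Lemma string_source i n b : basis_phi i b = n ->
  exists b0, basis_e_string i n b0 b.
Proof.
move=> phib; have [pi [[_ _ pi_surj] piR]] := ct_permutation hB i n.
have [|y [By Ry] yb] := pi_surj (val b).
  split; first by split; [exact: set_valP|apply/(basis_phiP hB); rewrite phib].
  by move=> /(basis_phiP hB); rewrite phib ltnn.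
have [c cy] : exists c : B, val c = y by exists (SigSub (mem_set By)).
exists c; split; [|exact: phib|].
  by apply/eqP; rewrite -leqn0 leqNgt; apply/negP => /(basis_phiP hB); rewrite cy.
have := piR y (conj By Ry); rewrite yb cy => Rb.
by rewrite -opprB -scaleN1r; exact: right_idealZ.
Qed.

Lemma string_target i n b0 : basis_phi i b0 = 0%N ->
  exists b, basis_e_string i n b0 b.
Proof.
move=> phi0; have [pi [[piB _ _] piR]] := ct_permutation hB i n.
have Rb0 : (B `\` right_ideal i 1)%classic (val b0).
  by split; [exact: set_valP|move=> /(basis_phiP hB); rewrite phi0].
have [[Bpi Rpi] Rpi'] := piB _ Rb0.
have [c cy] : exists c : B, val c = pi (val b0) by exists (SigSub (mem_set Bpi)).
exists c; split; [exact: phi0| |].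
  apply/eqP; rewrite eqn_leq; apply/andP; split.
    by rewrite leqNgt; apply/negP => /(basis_phiP hB); rewrite cy.
  by apply/(basis_phiP hB); rewrite cy.
have := piR _ Rb0; rewrite cy => Rb.
by rewrite -opprB -scaleN1r; exact: right_idealZ.
Qed.

(** The position and the source of b on its i-string are unique, so the [xget] in [basis_e] has only
    the expected value. *)
Lemma string_e i n b0 b : basis_e_string i n b0 b ->
  basis_e_string i n.+1 b0 (basis_e i b).
Proof.
move=> sb; have [phi0 phib _] := sb.
have : exists b', exists m b1, basis_e_string i m b1 b /\ basis_e_string i m.+1 b1 b'.
  by have [b' sb'] := string_target n.+1 phi0; exists b', n, b0.
move=> /(xgetPex b) [m [b1 [sb1 se]]].
have mn : m = n by rewrite -phib; case: sb1.
rewrite mn in sb1 se; suff -> : b0 = b1 by [].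
by apply/eqP; rewrite -(string_val_eq sb1 sb).
Qed.

Lemma basis_phi_e i b : basis_phi i (basis_e i b) = (basis_phi i b).+1.
Proof. by have [b0 /string_e[]] := string_source (erefl (basis_phi i b)). Qed.

Lemma basis_e_inj i : injective (@basis_e I A B i).
Proof.
move=> b c ebc; have bc : basis_phi i b = basis_phi i c.
  by apply: succn_inj; rewrite -!basis_phi_e ebc.
have [b0 sb] := string_source bc; have [c0 sc] := string_source (erefl (basis_phi i c)).
apply/eqP; rewrite (string_val_eq sc sb) -(string_val_eq (string_e sc) (string_e sb)).
by rewrite ebc.
Qed.

Lemma basis_e_surj i b : basis_phi i b != 0%N -> exists c, basis_e i c = b.
Proof.
case phib: (basis_phi i b) => [//|n] _.
have [b0 sb] := string_source phib; have [phi0 _ _] := sb.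
have [c sc] := string_target n phi0; exists c.
by apply/eqP; rewrite (string_val_eq sb (string_e sc)).
Qed.

(** b occurs with coefficient 1 in the product of the divided power with b0, which is homogeneous of
    weight nu. *)
Lemma basis_wt_string i n b0 b : basis_e_string i n b0 b ->
  basis_wt b = [ffun j => (n * alpha i j + basis_wt b0 j)%N].
Proof.
move=> sb; set nu := [ffun j => _].
have wE : wproj nu (theta_div A i n * val b0) = theta_div A i n * val b0.
  rewrite /theta_div /divpow -scalerAl linearZ; congr (_ *: _).
  by rewrite /= (@wproj_thetaX _ _ (basis_wt b0) nu _ _ _ (erefl nu)) (wproj_basis hB) eqxx.
have := string_coef hB (val b0) sb.
by rewrite (coef_val hB) eqxx -wE (coef_wproj hB); case: eqP.
Qed.

(** When all phi_i vanish, b has coefficient 0 in every element of every theta_i f; its coefficient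
    1 in itself must come from the scalars. *)
Lemma basis_lowest b : (forall i, basis_phi i b = 0%N) -> val b = 1.
Proof.
move=> b0; suff: coef B (val b) (val b) = 0 \/ val b = 1.
  by rewrite (coef_val hB) eqxx => -[/eqP|//]; rewrite oner_eq0.
(* Only the vector being expanded is generalised; the index b and the alternative b = 1 stay
   fixed. *)
have B1 := ct_one hB; elim/falg_word_ind: {2}(val b) => [a|i x|x y].
- rewrite (coefZ basisB) (coef_basis basisB) //.
  by case: eqP => [->|_]; [right|left; rewrite mulr0].
- left; apply: (coef_phi hB (i := i)); rewrite b0 -[theta A i]expr1.
  exact: right_idealX.
- move=> [x0|]; last by right.
  by case=> [y0|]; [left; rewrite (coefD basisB) x0 y0 addr0|right].
Qed.

Lemma basis_wt_lowest b : (forall i, basis_phi i b = 0%N) -> basis_wt b = [ffun=> 0%N].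
Proof.
move=> /basis_lowest b1; apply: (basis_wt_unique hB).
have -> : val b = \prod_(i <- [::]) theta A i by rewrite big_nil.
rewrite wproj_word.
have -> : word_wt [::] = [ffun=> 0%N] :> {ffun I -> nat} by apply/ffunP => i; rewrite !ffunE.
by rewrite eqxx big_nil oner_neq0.
Qed.

Lemma basis_lowest_weight_crystal : lowest_weight_crystal (basis_crystal B).
Proof.
split=> /=.
- exact: basis_phi_e.
- move=> i b c; rewrite /basis_f; case: eqP => [b0|/eqP b0].
    by split=> // ec; move: b0; rewrite -ec basis_phi_e.
  have ex := basis_e_surj b0; have /= eE := xgetPex b ex.
  by split=> [[<-//]|ec]; congr Some; apply: (@basis_e_inj i); rewrite eE.
- by move=> i b; rewrite /basis_f; case: eqP.
- move=> i b; have [b0 sb] := string_source (erefl (basis_phi i b)).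
  rewrite (basis_wt_string sb) (basis_wt_string (string_e sb)) /height.
  rewrite (bigD1 i) //= [in RHS](bigD1 i) //= !ffunE eqxx !muln1 !addSn; congr _.+1.
  congr addn; apply: eq_bigr => j /negPf ji; rewrite !ffunE.
  by rewrite eq_sym ji !muln0.
- move=> b /basis_wt_lowest ->; rewrite /height big1 // => i _; exact: ffunE.
- by move=> b c /basis_lowest b1 /basis_lowest c1; apply: val_inj; rewrite /= b1 c1.
Qed.

End Strings.

(** * Transition matrices and the involution *)

Section Sigma.
Variables (I : finType) (A : I -> I -> int).

Lemma frevK : involutive (@frev I).
Proof.
move=> x; have -> : frev x = \sum_(w <- msupp x) << x@_w *g FMonom (rev w) >>.
  by rewrite {1}[x]monalgE raddf_sum; apply: eq_bigr => w _; exact: frevU.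
rewrite raddf_sum [RHS]monalgE; apply: eq_bigr => w _.
by rewrite /= frevU /= revK fmK.
Qed.

Lemma sigmaK : involutive (@sigma I A).
Proof. by move=> x; have [y ->] := fpi_surj x; rewrite !sigma_pi frevK. Qed.

Variables (B : set (falg A)) (hB : canonical_type B).
Implicit Types b : B.

Lemma val_basis_sigma b : val (basis_sigma b) = sigma (val b).
Proof.
have Bs := ct_sigma hB (set_valP b).
have ex : exists c : B, val c = sigma (val b) by exists (SigSub (mem_set Bs)).
exact: (xgetPex b ex).
Qed.

Lemma basis_sigmaK : involutive (@basis_sigma I A B).
Proof. by move=> b; apply: val_inj; rewrite /= !val_basis_sigma sigmaK. Qed.

(** [sigma] is linear and permutes B, hence permutes coordinates. *)
Lemma coef_sigma b x :
  coef B (val (basis_sigma b)) (sigma x) = coef B (val b) x.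
Proof.
have basisB := ct_basis hB.
elim/(basis_linear_ind basisB): x => [|a x y Bx IHy].
  have -> : sigma (0 : falg A) = 0.
    by have := sigma_linear (-1) (0 : falg A) 0; rewrite !scaleN1r oppr0 addr0 addNr.
  by rewrite !(coef0 basisB).
rewrite sigma_linear (coefP basisB _ a (sigma x)) (coefP basisB _ a x) [X in _ + X]IHy.
have [c ->] : exists c : B, x = val c by exists (SigSub (mem_set Bx)).
suff -> : coef B (val (basis_sigma b)) (sigma (val c)) = coef B (val b) (val c) by [].
by rewrite -val_basis_sigma !(coef_val hB) (inj_eq (inv_inj basis_sigmaK)).
Qed.

End Sigma.

(** * Coefficients between two bases of canonical type *)

Section TransitionMatrix.
Variables (I : finType) (A : I -> I -> int) (B' B'' : set (falg A)).
Hypotheses (hB' : canonical_type B') (hB'' : canonical_type B'').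

(** If b' lies in theta_i^p f, so does every element of B'' occurring in it. *)
Lemma coef_neq0_phi i (b' : B') (b'' : B'') : coef B'' (val b'') (val b') != 0 ->
  (basis_phi i b' <= basis_phi i b'')%N.
Proof.
move=> nz; apply/(basis_phiP hB''); move: b'' nz; apply/(right_ideal_coef hB'').
exact/(basis_phiP hB').
Qed.

Lemma coef_neq0_wt (b' : B') (b'' : B'') : coef B'' (val b'') (val b') != 0 ->
  basis_wt b' = basis_wt b''.
Proof.
have <- : wproj (basis_wt b') (val b') = val b' by rewrite (wproj_basis hB') eqxx.
by rewrite (coef_wproj hB''); case: (_ =P basis_wt b') => //; rewrite eqxx.
Qed.

Lemma coef_string i n (b0' b' : B') (b0'' b'' : B'') :
  basis_e_string i n b0' b' -> basis_e_string i n b0'' b'' ->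
  coef B'' (val b'') (val b') = coef B'' (val b0'') (val b0').
Proof.
by move=> [_ _ Rb'] s''; rewrite (string_coef_congr hB'' s'' Rb') (string_coef hB'' _ s'').
Qed.

(** Equality of phi_i puts b' and b'' at the same position on their strings; both coefficients then
    equal the one between the sources. *)
Lemma coef_e i (b' : B') (b'' : B'') : basis_phi i b' = basis_phi i b'' ->
  coef B'' (val (basis_e i b'')) (val (basis_e i b')) = coef B'' (val b'') (val b').
Proof.
move=> phi_eq; have [b0' s'] := string_source hB' phi_eq.
have [b0'' s''] := string_source hB'' (erefl (basis_phi i b'')).
by rewrite (coef_string s' s'') (coef_string (string_e hB' s') (string_e hB'' s'')).
Qed.

Lemma coef_basis_sigma (b' : B') (b'' : B'') :
  coef B'' (val (basis_sigma b'')) (val (basis_sigma b')) =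
  coef B'' (val b'') (val b').
Proof. by rewrite (val_basis_sigma hB') (coef_sigma hB''). Qed.

Variables (X : crystal I) (beta' : X -> basis_crystal B')
  (beta'' : X -> basis_crystal B'').
Hypotheses (iso' : crystal_iso beta') (iso'' : crystal_iso beta'').
Implicit Types x y : X.

Let hX : lowest_weight_crystal X :=
  lowest_weight_crystal_iso iso' (basis_lowest_weight_crystal hB').

Definition transition y x : rat :=
  coef B'' (val (beta'' y : B'')) (val (beta' x : B')).

Lemma transition_e i x y : cr_phi i x = cr_phi i y ->
  transition (cr_e i y) (cr_e i x) = transition y x.
Proof.
move=> xy; rewrite /transition -(iso_e iso') -(iso_e iso''); apply: coef_e.
by rewrite -[LHS]/(cr_phi i (beta' x)) -[RHS]/(cr_phi i (beta'' y)) (iso_phi iso') (iso_phi iso'').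
Qed.

Lemma transition_diag x : transition x x = 1.
Proof.
move: x; apply: (lw_ind hX) => [x x0|i x IHx]; last by rewrite transition_e.
rewrite /transition; have -> : val (beta' x : B') = val (beta'' x : B'').
  rewrite (@basis_lowest _ _ _ hB') ?(@basis_lowest _ _ _ hB'') // => i.
    by rewrite -[LHS]/(cr_phi i (beta'' x)) (iso_phi iso'').
  by rewrite -[LHS]/(cr_phi i (beta' x)) (iso_phi iso').
by rewrite (coef_val hB'') eqxx.
Qed.

(** Non-vanishing of the coefficient is stable under [approx], so coinduction applies. Invariance
    under the involution is a hypothesis because it is first applied with the identity as
    involution. *)
Lemma transition_le_str :
  (forall x y, transition (cr_sigma y) (cr_sigma x) = transition y x) ->
  forall x y, transition y x != 0 -> le_str x y.
Proof.
move=> trsigma x y nz; split.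
  by rewrite -(iso_wt iso') -(iso_wt iso''); exact: coef_neq0_wt nz.
move: nz; apply: (phi_dominated_sub (P := fun x y => transition y x != 0)).
  move=> {}x {}y nz i; rewrite -(iso_phi iso') -(iso_phi iso'').
  exact: coef_neq0_phi nz.
move=> {}x {}y [x' y'] nz [] /=; first by case=> i [xy [-> ->]]; rewrite transition_e.
  case=> i [xy y0 /(lw_fP hX) fx /(lw_fP hX) fy].
  (* A step along f_i is a step along e_i read backwards. *)
  rewrite -(@transition_e i) ?fx ?fy //.
  by apply: succn_inj; rewrite -!(lw_phi_e hX) fx fy.
by case=> -> ->; rewrite trsigma.
Qed.

End TransitionMatrix.

(** * Crystal isomorphisms commute with sigma *)

Section IsoSigma.
Variables (I : finType) (A : I -> I -> int) (B B' : set (falg A)).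
Hypotheses (hB : canonical_type B) (hB' : canonical_type B').
Variables (X : crystal I) (beta : X -> basis_crystal B)
  (beta' : X -> basis_crystal B').
Hypotheses (iso : crystal_iso beta) (iso' : crystal_iso beta').

Lemma crystal_iso_sigma :
  (forall x, beta (cr_sigma x) = cr_sigma (beta x)) ->
  forall x, beta' (cr_sigma x) = cr_sigma (beta' x).
Proof.
move=> beta_sigma x.
have sigmaXK : involutive (@cr_sigma I X).
  move=> y; apply: (bij_inj (iso_bij iso)); rewrite !beta_sigma.
  exact: (basis_sigmaK hB).
have [g gK Kg] := iso_bij iso'.
(* Replacing the involution by the identity removes it from the string relation,
   so that triangularity does not yet require compatibility with sigma. *)
pose X0 := @Crystal I X (@cr_wt I X) (@cr_phi I X) (@cr_e I X) (@cr_f I X) id.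
have iso0 : @crystal_iso I X0 _ beta by case: iso.
have iso0' : @crystal_iso I X0 _ beta' by case: iso'.
(* Since g inverts [beta'], h fixes y exactly when [beta'] sends y to the conjugate by the
   involutions of its own value. *)
pose h (y : X0) : X0 := g (cr_sigma (beta' (cr_sigma (y : X)))).
have h_inj : injective h.
  move=> y z /(bij_inj (Bijective Kg gK)) /(inv_inj (basis_sigmaK hB')).
  by move/(bij_inj (iso_bij iso'))/(inv_inj sigmaXK).
(* Removing sigma on both sides turns the coefficient of h y in y into a diagonal one, at
   [cr_sigma y], which is 1. *)
have h_le y : le_str y (h y).
  apply: (transition_le_str hB hB' iso0 iso0') => //.
  rewrite /transition /h Kg -[y in beta y]sigmaXK beta_sigma.
  rewrite (coef_basis_sigma hB hB') -/(transition beta beta' _ _).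
  by rewrite (transition_diag hB hB' iso iso') oner_neq0.
have hX0 : lowest_weight_crystal X0.
  exact: lowest_weight_crystal_iso iso0 (basis_lowest_weight_crystal hB).
have hx : h x = x := le_str_inj_id hX0 h_inj h_le x.
by rewrite -[in RHS]hx /h Kg; rewrite -[LHS](basis_sigmaK hB').
Qed.

End IsoSigma.

Theorem proposition2p6 (I : finType) (A : I -> I -> int)
    (hA : symmetrizable_gcm A) (X : crystal I) (hX : is_B_infty A X) :
  Relation_Definitions.order X (@le_str I X) /\
  forall (B' B'' : set (falg A))
    (hB' : canonical_type B') (hB'' : canonical_type B'')
    (beta' : X -> basis_crystal B') (beta'' : X -> basis_crystal B'')
    (hbeta' : crystal_iso beta') (hbeta'' : crystal_iso beta''),
  let c (b'' b' : X) : rat :=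
    coef B'' (val (beta'' b'' : B'')) (val (beta' b' : B')) in
  (forall b : X, c b b = 1) /\
  (forall b' b'' : X, c b'' b' != 0 -> le_str b' b'').
Proof.
case: hX => B hB [h iso h_sigma]; split.
  apply: le_str_order.
  exact: lowest_weight_crystal_iso iso (basis_lowest_weight_crystal hB).
move=> B' B'' hB' hB'' beta' beta'' iso' iso'' c; split.
  exact: (transition_diag hB' hB'' iso' iso'').
apply: (transition_le_str hB' hB'' iso' iso'') => x y.
(* The definition of the common crystal gives compatibility with sigma for h only; it is transferred
   to [beta'] and [beta'']. *)
rewrite /transition (crystal_iso_sigma hB hB' iso iso' h_sigma).
rewrite (crystal_iso_sigma hB hB'' iso iso'' h_sigma).
exact: coef_basis_sigma.
Qed.
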